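(* Let $\mathcal B$ be an extriangulated category with enough projectives and enough injectives, and let $(\mathcal C,\mathcal C^{\perp_1})$ be a cotorsion pair. Then every object $X$ admits: a conflation $X\overset{t}{\rightarrowtail}T_0\twoheadrightarrow C_0$ with $T_0\in\mathcal C^{\perp_1}$, $C_0\in\mathcal C$; a conflation $Y_0\overset{y_0}{\rightarrowtail}P_0\overset{p_0}{\twoheadrightarrow}T_0$ with $P_0$ projective; a conflation $U_0\overset{u_0}{\rightarrowtail}P_0\twoheadrightarrow C_0$ (so $U_0\in\Omega\mathcal C$); and a conflation $Y_0\overset{g_0}{\rightarrowtail}U_0\overset{f_0}{\twoheadrightarrow}X$, such that $u_0g_0=y_0$ and $tf_0=p_0u_0$, and such that $f_0$ is a right $\Omega\mathcal C$-approximation of $X$. Moreover, if $B$ is an object with $\mathbb E(T_0,B)=0$, then $\operatorname{Hom}_{\mathcal B}(g_0,B):\operatorname{Hom}_{\mathcal B}(U_0,B)\to\operatorname{Hom}_{\mathcal B}(Y_0,B)$ is surjective.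
   Context: $(\mathcal B,\mathbb E,\mathfrak s)$ is an extriangulated category (Nakaoka–Palu); conflations $A\rightarrowtail B\twoheadrightarrow C$. Subcategories are full, additive, closed under isomorphisms and finite direct sums. $\mathcal P$ = projectives. $\mathcal C^{\perp_1}=\{B\mid\mathbb E(\mathcal C,B)=0\}$. $\Omega\mathcal C=\operatorname{CoCone}(\mathcal P,\mathcal C)$ is the class of objects $U$ admitting a conflation $U\rightarrowtail P\twoheadrightarrow C$ with $P\in\mathcal P$, $C\in\mathcal C$. A cotorsion pair $(\mathcal U,\mathcal V)$: subcategories closed under summands with $\mathbb E(\mathcal U,\mathcal V)=0$ and every $B$ admits conflations $V_B\rightarrowtail U_B\twoheadrightarrow B$, $B\rightarrowtail V^B\twoheadrightarrow U^B$ with $U_B,U^B\in\mathcal U$, $V_B,V^B\in\mathcal V$. *)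

(* Defs.v *)
From HB Require Import structures.
From mathcomp Require Import all_boot all_algebra.
Set Implicit Arguments. Unset Strict Implicit. Unset Printing Implicit Defensive.
Import GRing.Theory.
Local Open Scope ring_scope.

Record CatData := {
  Ob :> Type;
  Mor : Ob -> Ob -> zmodType;
  comp : forall A B C : Ob, Mor B C -> Mor A B -> Mor A C;
  idm : forall A : Ob, Mor A A;
  zobj : Ob;
  bip : Ob -> Ob -> Ob;
  bin1 : forall A B : Ob, Mor A (bip A B);
  bin2 : forall A B : Ob, Mor B (bip A B);
  bpr1 : forall A B : Ob, Mor (bip A B) A;
  bpr2 : forall A B : Ob, Mor (bip A B) B }.

Arguments Mor {c} _ _.
Arguments comp {c A B C} _ _.
Arguments idm {c} A.
Arguments zobj {c}.
Arguments bip {c} _ _.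
Arguments bin1 {c A B}.
Arguments bin2 {c A B}.
Arguments bpr1 {c A B}.
Arguments bpr2 {c A B}.

Notation "g \oc f" := (comp g f) (at level 40, left associativity).

Definition AddCatAx (B : CatData) : Prop :=
  (forall (A A1 A2 A3 : B) (h : Mor A2 A3) (g : Mor A1 A2) (f : Mor A A1),
      h \oc (g \oc f) = (h \oc g) \oc f) /\
  (forall (A A1 : B) (f : Mor A A1), idm A1 \oc f = f) /\
  (forall (A A1 : B) (f : Mor A A1), f \oc idm A = f) /\
  (forall (A A1 A2 : B) (g1 g2 : Mor A1 A2) (f : Mor A A1),
      (g1 + g2) \oc f = g1 \oc f + g2 \oc f) /\
  (forall (A A1 A2 : B) (g : Mor A1 A2) (f1 f2 : Mor A A1),
      g \oc (f1 + f2) = g \oc f1 + g \oc f2) /\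
  (forall (X : B) (f : Mor (@zobj B) X), f = 0) /\
  (forall (X : B) (f : Mor X (@zobj B)), f = 0) /\
  (forall A1 A2 : B,
      bpr1 \oc (@bin1 _ A1 A2) = idm A1 /\ bpr2 \oc (@bin2 _ A1 A2) = idm A2 /\
      bpr1 \oc (@bin2 _ A1 A2) = 0 /\ bpr2 \oc (@bin1 _ A1 A2) = 0 /\
      bin1 \oc bpr1 + bin2 \oc bpr2 = idm (bip A1 A2)).

Definition is_iso (B : CatData) (X Y : B) (f : Mor X Y) : Prop :=
  exists g : Mor Y X, g \oc f = idm X /\ f \oc g = idm Y.

Definition isomorphic (B : CatData) (X Y : B) : Prop :=
  exists f : Mor X Y, is_iso f.

Definition mapsum (B : CatData) (A A' B1 B1' : B) (f : Mor A B1) (f' : Mor A' B1')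
  : Mor (bip A A') (bip B1 B1') :=
  (bin1 \oc f) \oc bpr1 + (bin2 \oc f') \oc bpr2.

(* Ext E C A stands for E(C, A). *)
Record ExtData (B : CatData) := {
  Ext : B -> B -> zmodType;
  push : forall (C A A' : B), Mor A A' -> Ext C A -> Ext C A';
  pull : forall (C C' A : B), Mor C' C -> Ext C A -> Ext C' A }.

Arguments Ext {B} e _ _.
Arguments push {B e C A A'} _ _.
Arguments pull {B e C C' A} _ _.

Definition ExtFunAx (B : CatData) (E : ExtData B) : Prop :=
  (forall (C A A' : B) (a : Mor A A') (d1 d2 : Ext E C A),
      push a (d1 + d2) = push a d1 + push a d2) /\
  (forall (C A A' : B) (a1 a2 : Mor A A') (d : Ext E C A),
      push (a1 + a2) d = push a1 d + push a2 d) /\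
  (forall (C A A' A'' : B) (a' : Mor A' A'') (a : Mor A A') (d : Ext E C A),
      push (a' \oc a) d = push a' (push a d)) /\
  (forall (C A : B) (d : Ext E C A), push (idm A) d = d) /\
  (forall (C C' A : B) (c : Mor C' C) (d1 d2 : Ext E C A),
      pull c (d1 + d2) = pull c d1 + pull c d2) /\
  (forall (C C' A : B) (c1 c2 : Mor C' C) (d : Ext E C A),
      pull (c1 + c2) d = pull c1 d + pull c2 d) /\
  (forall (C C' C'' A : B) (c : Mor C' C) (c' : Mor C'' C') (d : Ext E C A),
      pull (c \oc c') d = pull c' (pull c d)) /\
  (forall (C A : B) (d : Ext E C A), pull (idm C) d = d) /\
  (forall (C C' A A' : B) (a : Mor A A') (c : Mor C' C) (d : Ext E C A),
      push a (pull c d) = pull c (push a d)).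

Definition extsum (B : CatData) (E : ExtData B) (A C A' C' : B)
  (d : Ext E C A) (d' : Ext E C' A') : Ext E (bip C C') (bip A A') :=
  push (@bin1 _ A A') (pull (@bpr1 _ C C') d) + push (@bin2 _ A A') (pull (@bpr2 _ C C') d').

(* s A B C delta x y  :<->  s(delta) = [A -x-> B -y-> C] *)
Definition Realization (B : CatData) (E : ExtData B) :=
  forall A B1 C : B, Ext E C A -> Mor A B1 -> Mor B1 C -> Prop.

Definition realizes (B : CatData) (E : ExtData B) (s : Realization E)
  (A B1 C : B) (d : Ext E C A) (x : Mor A B1) (y : Mor B1 C) : Prop := s A B1 C d x y.

Definition ExtriAx (B : CatData) (E : ExtData B) (s : Realization E) : Prop :=
  (* s(delta) is an equivalence class of sequences *)
  (forall (A C : B) (d : Ext E C A), exists (B1 : B) (x : Mor A B1) (y : Mor B1 C),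
      realizes s d x y) /\
  (forall (A B1 B1' C : B) (d : Ext E C A) (x : Mor A B1) (y : Mor B1 C)
          (x' : Mor A B1') (y' : Mor B1' C),
      realizes s d x y ->
      (realizes s d x' y' <->
       exists b : Mor B1 B1', is_iso b /\ b \oc x = x' /\ y' \oc b = y)) /\
  (forall (A B1 C A' B1' C' : B) (d : Ext E C A) (d' : Ext E C' A')
          (x : Mor A B1) (y : Mor B1 C) (x' : Mor A' B1') (y' : Mor B1' C')
          (a : Mor A A') (c : Mor C C'),
      realizes s d x y -> realizes s d' x' y' -> push a d = pull c d' ->
      exists b : Mor B1 B1', b \oc x = x' \oc a /\ y' \oc b = c \oc y) /\
  (forall A C : B, realizes s (0 : Ext E C A) (@bin1 _ A C) (@bpr2 _ A C)) /\
  (forall (A B1 C A' B1' C' : B) (d : Ext E C A) (d' : Ext E C' A')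
          (x : Mor A B1) (y : Mor B1 C) (x' : Mor A' B1') (y' : Mor B1' C'),
      realizes s d x y -> realizes s d' x' y' ->
      realizes s (extsum d d') (mapsum x x') (mapsum y y')) /\
  (forall (A B1 C A' B1' C' : B) (d : Ext E C A) (d' : Ext E C' A')
          (x : Mor A B1) (y : Mor B1 C) (x' : Mor A' B1') (y' : Mor B1' C')
          (a : Mor A A') (b : Mor B1 B1'),
      realizes s d x y -> realizes s d' x' y' -> b \oc x = x' \oc a ->
      exists c : Mor C C', c \oc y = y' \oc b /\ push a d = pull c d') /\
  (forall (A B1 C A' B1' C' : B) (d : Ext E C A) (d' : Ext E C' A')
          (x : Mor A B1) (y : Mor B1 C) (x' : Mor A' B1') (y' : Mor B1' C')
          (b : Mor B1 B1') (c : Mor C C'),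
      realizes s d x y -> realizes s d' x' y' -> c \oc y = y' \oc b ->
      exists a : Mor A A', b \oc x = x' \oc a /\ push a d = pull c d') /\
  (forall (A B1 C D F : B) (f : Mor A B1) (f' : Mor B1 D) (g : Mor B1 C) (g' : Mor C F)
          (d : Ext E D A) (d' : Ext E F B1),
      realizes s d f f' -> realizes s d' g g' ->
      exists (E0 : B) (h' : Mor C E0) (dd : Mor D E0) (e : Mor E0 F) (d'' : Ext E E0 A),
        realizes s d'' (g \oc f) h' /\ realizes s (push f' d') dd e /\
        dd \oc f' = h' \oc g /\ e \oc h' = g' /\
        pull dd d'' = d /\ push f d'' = pull e d') /\
  (forall (D A B1 F C : B) (f' : Mor D A) (f : Mor A B1) (g' : Mor F B1) (g : Mor B1 C)
          (d : Ext E B1 D) (d' : Ext E C F),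
      realizes s d f' f -> realizes s d' g' g ->
      exists (E0 : B) (h' : Mor E0 A) (dd : Mor D E0) (e : Mor E0 F) (d'' : Ext E C E0),
        realizes s d'' h' (g \oc f) /\ realizes s (pull g' d) dd e /\
        h' \oc dd = f' /\ g' \oc e = f \oc h' /\
        push dd d = pull g d'' /\ push e d'' = d').

Section Derived.
Variables (B : CatData) (E : ExtData B) (s : Realization E).

Definition conflation (A B1 C : B) (x : Mor A B1) (y : Mor B1 C) : Prop :=
  exists d : Ext E C A, realizes s d x y.

Definition projective (P : B) : Prop :=
  forall (A B1 C : B) (x : Mor A B1) (y : Mor B1 C), conflation x y ->
  forall c : Mor P C, exists b : Mor P B1, y \oc b = c.

Definition injective (I : B) : Prop :=
  forall (A B1 C : B) (x : Mor A B1) (y : Mor B1 C), conflation x y ->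
  forall a : Mor A I, exists b : Mor B1 I, b \oc x = a.

Definition enough_projectives : Prop :=
  forall C : B, exists (A P : B) (x : Mor A P) (y : Mor P C), projective P /\ conflation x y.

Definition enough_injectives : Prop :=
  forall A : B, exists (I C : B) (x : Mor A I) (y : Mor I C), injective I /\ conflation x y.

Definition subcategory (U : B -> Prop) : Prop :=
  (forall X Y : B, isomorphic X Y -> U X -> U Y) /\ U zobj /\
  (forall X Y : B, U X -> U Y -> U (bip X Y)).

Definition closed_summands (U : B -> Prop) : Prop :=
  forall X A A' : B, U X -> isomorphic X (bip A A') -> U A.

Definition perp1 (U : B -> Prop) (Y : B) : Prop :=
  forall C : B, U C -> forall d : Ext E C Y, d = 0.

Definition cotorsion_pair (U V : B -> Prop) : Prop :=
  subcategory U /\ subcategory V /\ closed_summands U /\ closed_summands V /\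
  (forall C A : B, U C -> V A -> forall d : Ext E C A, d = 0) /\
  (forall X : B, exists (VX UX : B) (v : Mor VX UX) (u : Mor UX X),
      V VX /\ U UX /\ conflation v u) /\
  (forall X : B, exists (VX UX : B) (v : Mor X VX) (u : Mor VX UX),
      V VX /\ U UX /\ conflation v u).

Definition OmegaC (U : B -> Prop) (X : B) : Prop :=
  exists (P C : B) (x : Mor X P) (y : Mor P C), projective P /\ U C /\ conflation x y.

Definition right_approx (D : B -> Prop) (W X : B) (f : Mor W X) : Prop :=
  D W /\ forall (W' : B) (w : Mor W' X), D W' -> exists h : Mor W' W, f \oc h = w.

End Derived.

(* Main.v *)
Require Import Defs.
From HB Require Import structures.
From mathcomp Require Import all_boot all_algebra.
Import GRing.Theory.
Local Open Scope ring_scope.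

(* Take the right C^{perp_1}-approximation conflation [X -t-> T0 -t'-> C0] and a
   conflation eps = [Y0 -y0-> P0 -p0-> T0] with P0 projective; (ET4)^op applied
   to the deflations p0 and t' yields U0 in Omega C together with a conflation
   [Y0 -g0-> U0 -f0-> X] realizing t^* eps.  For W in Omega C, with conflation
   [W -x-> P -> C], a map w : W -> X satisfies w^* t^* eps = 0: since
   E(C, T0) = 0, t w extends along x to P, and since P is projective that
   extension factors through p0, which kills eps.  Hence w factors through f0.
   Similarly phi_* t^* eps = t^* phi_* eps = 0 when E(T0, B) = 0, so phi extends
   along g0. *)

Lemma additive_map0 (U V : zmodType) (f : U -> V) :
  (forall x y, f (x + y) = f x + f y) -> f 0 = 0.
Proof. by move=> fD; apply: (addrI (f 0)); rewrite -fD !addr0. Qed.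

Section Extriangulated.
Context {B : CatData} {E : ExtData B} {s : Realization E}.
Hypotheses (HB : AddCatAx B) (HE : ExtFunAx E) (Hs : ExtriAx s).

Lemma compA {A A1 A2 A3 : B} (h : Mor A2 A3) (g : Mor A1 A2) (f : Mor A A1) :
  h \oc (g \oc f) = (h \oc g) \oc f.
Proof. by case: HB. Qed.

Lemma pullM {C C' C'' A : B} (c : Mor C' C) (c' : Mor C'' C') (d : Ext E C A) :
  pull (c \oc c') d = pull c' (pull c d).
Proof. by case: HE => _ [_ [_ [_ [_ [_ []]]]]]. Qed.

Lemma push_pull {C C' A A' : B} (a : Mor A A') (c : Mor C' C) (d : Ext E C A) :
  push a (pull c d) = pull c (push a d).
Proof. by case: HE => _ [_ [_ [_ [_ [_ [_ []]]]]]]. Qed.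

Lemma push_ext0 {C A A' : B} (a : Mor A A') : push a (0 : Ext E C A) = 0.
Proof. by case: HE => pushD _; apply: additive_map0. Qed.

Lemma pull_ext0 {C C' A : B} (c : Mor C' C) : pull c (0 : Ext E C A) = 0.
Proof. by case: HE => _ [_ [_ [_ [pullD _]]]]; apply: additive_map0. Qed.

Lemma realizes_split {A C : B} : realizes s (0 : Ext E C A) Defs.bin1 bpr2.
Proof. by case: Hs => _ [_ [_ []]]. Qed.

Lemma pull_deflation_eq0 {A B1 C : B} {d : Ext E C A} {x : Mor A B1} {y : Mor B1 C} :
  realizes s d x y -> pull y d = 0.
Proof.
move=> Hd; case: Hs => _ [_ [_ [_ [_ [_ [ET3op _]]]]]].
have [a [_ <-]] := ET3op _ _ _ _ _ _ _ _ _ _ _ _ bpr2 y (@realizes_split A B1) Hd erefl.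
exact: push_ext0.
Qed.

Lemma pull_comp_deflation_eq0 {A B1 C W : B} {d : Ext E C A} {x : Mor A B1}
    {y : Mor B1 C} (c : Mor W B1) :
  realizes s d x y -> pull (y \oc c) d = 0.
Proof. by move=> Hd; rewrite pullM (pull_deflation_eq0 Hd) pull_ext0. Qed.

(* Both lemmas realize a morphism of extensions, (idm, w) resp. (a, idm), between
   d and a split conflation. *)
Lemma deflation_lift {A B1 C W : B} {d : Ext E C A} {x : Mor A B1} {y : Mor B1 C}
    {w : Mor W C} :
  realizes s d x y -> pull w d = 0 -> exists h : Mor W B1, y \oc h = w.
Proof.
move=> Hd Hw; case: HB => _ [_ [idr [_ [_ [_ [_ Hbip]]]]]].
case: Hs => _ [_ [Hmor _]].
have Heq : push (idm A) (0 : Ext E W A) = pull w d by rewrite push_ext0 Hw.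
have [b [_ Hb]] := Hmor _ _ _ _ _ _ _ _ _ _ _ _ _ _ realizes_split Hd Heq.
have [_ [pr2in2 _]] := Hbip A W.
by exists (b \oc Defs.bin2); rewrite compA Hb -compA pr2in2 idr.
Qed.

Lemma inflation_extend {A B1 C Z : B} {d : Ext E C A} {x : Mor A B1} {y : Mor B1 C}
    {a : Mor A Z} :
  realizes s d x y -> push a d = 0 -> exists h : Mor B1 Z, h \oc x = a.
Proof.
move=> Hd Ha; case: HB => _ [idl [_ [_ [_ [_ [_ Hbip]]]]]].
case: Hs => _ [_ [Hmor _]].
have Heq : push a d = pull (idm C) (0 : Ext E C Z) by rewrite pull_ext0 Ha.
have [b [Hb _]] := Hmor _ _ _ _ _ _ _ _ _ _ _ _ _ _ Hd realizes_split Heq.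
have [pr1in1 _] := Hbip Z C.
by exists (bpr1 \oc b); rewrite -compA Hb compA pr1in1 idl.
Qed.

Variable Cc : B -> Prop.

Lemma pullback_right_OmegaC_approx {X T0 Y0 P0 U0 : B} {t : Mor X T0}
    {eps : Ext E T0 Y0} {y0 : Mor Y0 P0} {p0 : Mor P0 T0}
    {g0 : Mor Y0 U0} {f0 : Mor U0 X} :
  perp1 E Cc T0 -> realizes s eps y0 p0 ->
  realizes s (pull t eps) g0 f0 -> OmegaC s Cc U0 ->
  right_approx (OmegaC s Cc) f0.
Proof.
move=> HT0 Heps Hkappa HU0; split=> // W w [P [C [x [y [HP [HC [dl Hdl]]]]]]].
have [b Hbx] : exists b : Mor P T0, b \oc x = t \oc w.
  by apply: inflation_extend Hdl _; apply: HT0.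
have [c Hc] : exists c : Mor P P0, p0 \oc c = b.
  exact: HP (ex_intro _ eps Heps) b.
apply: deflation_lift Hkappa _.
by rewrite -pullM -Hbx -Hc pullM (pull_comp_deflation_eq0 _ Heps) pull_ext0.
Qed.

End Extriangulated.

Theorem mainTheorem6 (B : CatData) (HB : AddCatAx B) (E : ExtData B) (HE : ExtFunAx E)
  (s : Realization E) (Hs : ExtriAx s)
  (Hproj : enough_projectives s) (Hinj : enough_injectives s)
  (Cc : B -> Prop) (Hcot : cotorsion_pair s Cc (perp1 E Cc)) (X : B) :
  exists (T0 C0 : B) (t : Mor X T0) (t' : Mor T0 C0),
    conflation s t t' /\ perp1 E Cc T0 /\ Cc C0 /\
  exists (Y0 P0 : B) (y0 : Mor Y0 P0) (p0 : Mor P0 T0),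
    conflation s y0 p0 /\ projective s P0 /\
  exists (U0 : B) (u0 : Mor U0 P0) (q0 : Mor P0 C0),
    conflation s u0 q0 /\
  exists (g0 : Mor Y0 U0) (f0 : Mor U0 X),
    conflation s g0 f0 /\ u0 \oc g0 = y0 /\ t \oc f0 = p0 \oc u0 /\
    right_approx (OmegaC s Cc) f0 /\
    (forall B1 : B, (forall d : Ext E T0 B1, d = 0) ->
       forall phi : Mor Y0 B1, exists psi : Mor U0 B1, psi \oc g0 = phi).
Proof.
case: Hcot => _ [_ [_ [_ [_ [_ Hright]]]]].
have [T0 [C0 [t [t' [HT0 [HC0 [delta Hdelta]]]]]]] := Hright X.
have [Y0 [P0 [y0 [p0 [HP0 [eps Heps]]]]]] := Hproj T0.
have [_ [_ [_ [_ [_ [_ [_ [_ ET4op]]]]]]]] := Hs.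
have [U0 [u0 [g0 [f0 [d0 [Hd0 [Hkappa [Hug [Htf _]]]]]]]]] :=
  ET4op _ _ _ _ _ _ _ _ _ _ _ Heps Hdelta.
have HU0 : OmegaC s Cc U0 by exists P0, C0, u0, (t' \oc p0); do 2!split=> //; exists d0.
exists T0, C0, t, t'; split; first by exists delta.
split=> //; split=> //.
exists Y0, P0, y0, p0; split; first by exists eps.
split=> //.
exists U0, u0, (t' \oc p0); split; first by exists d0.
exists g0, f0; split; first by exists (pull t eps).
do 2!split=> //; split.
  exact: (pullback_right_OmegaC_approx HB HE Hs Cc HT0 Heps Hkappa HU0).
move=> B1 HB1 phi; apply: (inflation_extend HB HE Hs Hkappa).
by rewrite (push_pull HE) (HB1 (push phi eps)) (pull_ext0 HE).
Qed.
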